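(* Let $A\in\mathbb{R}^{d\times d}$ be symmetric positive semidefinite with largest eigenvalue $\lambda_1$, and let $\beta>0$ satisfy $\lambda_1^2\ge4\beta$. Let $A_1,A_2,\dots$ be i.i.d. random $d\times d$ real matrices with $\mathbb{E}[A_t]=A$ and $\Sigma=\mathbb{E}[(A_t-A)\otimes(A_t-A)]$. Define $F_{-1}=0$, $F_0=I$, and $F_{t+1}=A_{t+1}F_t-\beta F_{t-1}$ for $t\ge0$. Then for every $t\ge 0$, $$\big\|\mathbb{E}[F_t\otimes F_t]-\mathbb{E}[F_t]\otimes\mathbb{E}[F_t]\big\|\le\sum_{n=1}^t\|\Sigma\|^n\beta^{t-n}\sum_{k\in S_{t-n}^{n+1}}\prod_{i=1}^{n+1}U_{k_i}^2\left(\frac{\lambda_1}{2\sqrt\beta}\right).$$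
   Context: $\|\cdot\|$ is the spectral norm and $\otimes$ the Kronecker product. $U_k$ is the Chebyshev polynomial of the second kind: $U_0=1$, $U_1(z)=2z$, $U_{k+1}(z)=2zU_k(z)-U_{k-1}(z)$. $\mathbb{N}=\{0,1,2,\dots\}$ and $S_m^n=\{k=(k_1,\dots,k_n)\in\mathbb{N}^n:\sum_{i=1}^nk_i=m\}$. The $A_t$ have finite second moments. *)

(* Defs.v *)
From HB Require Import structures.
From mathcomp Require Import all_boot all_order all_algebra.
From mathcomp Require Import all_classical all_reals all_analysis.
From mathcomp.real_closed Require Export mxtens.

Set Implicit Arguments.
Unset Strict Implicit.
Unset Printing Implicit Defensive.

Import Order.TTheory GRing.Theory Num.Theory numFieldNormedType.Exports.
Local Open Scope classical_set_scope.
Local Open Scope ring_scope.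

(** MathComp world (MathComp-Analysis, and [*t] of mathcomp-real-closed for the
    Kronecker product). *)

Definition l2norm (R : realType) (n : nat) (v : 'cV[R]_n) : R :=
  Num.sqrt (\sum_(i < n) v i 0 ^+ 2).

(** Operator norm induced by the Euclidean norms. The set is nonempty and
    bounded, so this [sup] is the genuine supremum. *)
Definition spectral_norm (R : realType) (m n : nat) (M : 'M[R]_(m, n)) : R :=
  sup [set l2norm (M *m v) | v in [set v : 'cV[R]_n | l2norm v <= 1]].

Definition possemidef (R : realType) (n : nat) (M : 'M[R]_n) : Prop :=
  forall v : 'cV[R]_n, 0 <= (v^T *m M *m v) 0 0.

(** [eigenvalue] is about left eigenvectors, which have the same eigenvalues as
    right ones. The first conjunct forces [0 < n]. *)
Definition largest_eigenvalue (R : realType) (n : nat) (M : 'M[R]_n) (l : R) :=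
  eigenvalue M l /\ forall mu : R, eigenvalue M mu -> mu <= l.

Fixpoint chebyshevU (R : realType) (k : nat) : {poly R} :=
  if k is k1.+1 then
    if k1 is k2.+1 then 'X *+ 2 * chebyshevU R k1 - chebyshevU R k2
    else 'X *+ 2
  else 1.

(** The tuples in N^n of sum [m]; bounding the components by [m] loses none. *)
Definition compositions (m n : nat) : {set {ffun 'I_n -> 'I_m.+1}} :=
  [set k : {ffun 'I_n -> 'I_m.+1} | (\sum_(i < n) k i)%N == m].

(** Real matrices with the Borel sigma-algebra. *)
Notation borel_matrix R m n := (g_sigma_algebraType (@open 'M[R]_(m, n))).

Section RandomMatrices.
Context {disp : measure_display} {T : measurableType disp} {R : realType}.
Variable P : probability T R.

(** Entrywise expectation. [fine] is harmless for integrable entries, but sends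
    an infinite expectation to 0. *)
Definition expect_mx (m n : nat) (X : T -> 'M[R]_(m, n)) : 'M[R]_(m, n) :=
  \matrix_(i, j) fine 'E_P[fun w => X w i j].

Definition finite_second_moments (m n : nat) (X : T -> 'M[R]_(m, n)) : Prop :=
  forall i j, (fun w => X w i j) \in Lfun P 2%:E.

Definition mutually_independent {disp' : measure_display}
    {T' : measurableType disp'} (X : nat -> {RV P >-> T'}) : Prop :=
  forall (J : seq nat) (B : nat -> set T'), uniq J ->
    (forall t, t \in J -> measurable (B t)) ->
    P (\bigcap_(t in [set` J]) (X t @^-1` B t)) =
      (\prod_(t <- J) P (X t @^-1` B t))%E.

Definition identically_distributed {disp' : measure_display}
    {T' : measurableType disp'} (X : nat -> {RV P >-> T'}) : Prop :=
  forall (s t : nat) (B : set T'), measurable B ->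
    distribution P (X s) B = distribution P (X t) B.

End RandomMatrices.

(** The pair [(F_t, F_(t-1))]; the sequence starts at index 0, so [a t] stands
    for [A_(t+1)]. *)
Fixpoint momentum_pair (R : realType) (d : nat) (beta : R)
    (a : nat -> 'M[R]_d) (t : nat) : 'M[R]_d * 'M[R]_d :=
  if t is s.+1 then
    let: (F, F') := momentum_pair beta a s in (a s *m F - beta *: F', F)
  else (1%:M, 0).

Definition momentum (R : realType) (d : nat) (beta : R)
    (a : nat -> 'M[R]_d) (t : nat) : 'M[R]_d :=
  (momentum_pair beta a t).1.

(* Main.v *)
(** Write [D_t = A_t - A] and [G_t = E F_t], so that [G_t] solves the recursion
    with [A_t] replaced by [A]. The second moments [E (F_t (x) F_t)],
    [E (F_t (x) F_(t-1))] and [E (F_(t-1) (x) F_t)] satisfy a closed linear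
    recursion, because [A_(t+1)] is independent of [F_t] and [F_(t-1)]; Duhamel's
    formula then gives [M_t = E (F_t (x) F_t)] as
    [G_t (x) G_t + \sum_(s < t) (G_(t-1-s) (x) G_(t-1-s)) Sigma M_s].
    By the spectral theorem [|G_k|^2 <= g_k := beta^k U_k(x)^2] where
    [x = lambda1 / (2 sqrt beta) >= 1], since [|U_k| <= U_k(x)] on [0, x].
    Unrolling the resulting scalar renewal inequality yields the convolution
    powers of [g]. *)

Require Import Defs.
From HB Require Import structures.
From mathcomp Require Import all_boot all_order all_algebra.
From mathcomp Require Import all_classical all_reals all_analysis.
From mathcomp.real_closed Require Import complex.
From mathcomp Require Import measurable_realfun spectral sesquilinear ring lra.

Set Implicit Arguments.
Unset Strict Implicit.
Unset Printing Implicit Defensive.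

Import Order.TTheory GRing.Theory Num.Theory numFieldNormedType.Exports.
Local Open Scope classical_set_scope.
Local Open Scope ring_scope.

(** * Chebyshev polynomials and compositions *)

(** The index set of the bound comes from cutting time at the steps where the noise acts. With n
    such steps there remain n + 1 noise-free blocks, whose lengths k_i sum to t - n because each
    noise step itself uses one unit of time; a block of length k costs at most g_k and each cut
    costs |Sigma|. The uncut path n = 0 is G_t (x) G_t, exactly what the theorem subtracts, so the
    sum starts at n = 1. The noise perturbs a single equation of the moment system: E (A_t (x) A_t)
    = A (x) A + Sigma, while A_t (x) I and I (x) A_t have the means A (x) I and I (x) A. Both mixed
    moments are carried along because the Kronecker product does not commute. The probabilistic
    obstacle is that products of entries of F_t are known to be integrable only through
    independence. Integrability and factorization of expectations are therefore propagated together,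
    one fresh matrix at a time. *)

Section ChebyshevBound.
Variable R : realType.
Implicit Types x y : R.

Lemma chebyshevU_recr x k : (chebyshevU R k.+2).[x] =
  2 * x * (chebyshevU R k.+1).[x] - (chebyshevU R k).[x].
Proof. by rewrite [chebyshevU R k.+2]/= !hornerE mulr2n; ring. Qed.

Lemma chebyshevU0 x : (chebyshevU R 0).[x] = 1.
Proof. by rewrite /= hornerE. Qed.

Lemma chebyshevU1 x : (chebyshevU R 1).[x] = 2 * x.
Proof. by rewrite /= hornerMn hornerX mulr_natl. Qed.

(** Monotonicity of U_k alone does not pass through the recurrence, which subtracts U_(k-1). The
    increments do: U_(k+2) - U_(k+1) = (2y - 2) U_(k+1) + (U_(k+1) - U_k), where every term is
    nonnegative and increasing for y >= 1. *)
Lemma chebyshevU_homo_ge1 y x k : 1 <= y -> y <= x ->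
  [/\ 0 <= (chebyshevU R k).[y], (chebyshevU R k).[y] <= (chebyshevU R k).[x],
      1 <= (chebyshevU R k.+1).[y] - (chebyshevU R k).[y] &
      (chebyshevU R k.+1).[y] - (chebyshevU R k).[y] <=
      (chebyshevU R k.+1).[x] - (chebyshevU R k).[x]].
Proof.
move=> y1 yx; elim: k => [|k [U0 Uyx d1 dyx]].
  by rewrite !chebyshevU0 !chebyshevU1; split; lra.
rewrite !chebyshevU_recr; split; [lra|lra|nra|].
have : (2 * y - 2) * (chebyshevU R k.+1).[y] <=
       (2 * x - 2) * (chebyshevU R k.+1).[x] by apply: ler_pM; lra.
lra.
Qed.

(** The constant k + 1 is U_k(1); it links the oscillating regime below 1 to the growing regime
    above 1. *)
Lemma chebyshevU_ge x k : 1 <= x -> k.+1%:R <= (chebyshevU R k).[x].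
Proof.
move=> x1; elim: k => [|k IHk]; first by rewrite chebyshevU0.
have [_ _ + _] := @chebyshevU_homo_ge1 x x k x1 (lexx x).
rewrite -[k.+2%:R]natr1; lra.
Qed.

(* [T = U_(k+1) - y U_k] is the Chebyshev polynomial of the first kind, and
   Pell's identity [T ^ 2 + (1 - y ^ 2) U_k ^ 2 = 1] bounds it by 1. *)
Lemma chebyshevU_le y k : `|y| <= 1 -> `|(chebyshevU R k).[y]| <= k.+1%:R.
Proof.
move=> y1; have {}y1 : -1 <= y <= 1 by rewrite -ler_norml.
have pell j : ((chebyshevU R j.+1).[y] - y * (chebyshevU R j).[y]) ^+ 2
    + (1 - y ^+ 2) * (chebyshevU R j).[y] ^+ 2 = 1.
  elim: j => [|j IHj]; first by rewrite chebyshevU0 chebyshevU1; ring.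
  by rewrite -[RHS]IHj chebyshevU_recr; ring.
elim: k => [|k IHk]; first by rewrite chebyshevU0 normr1.
have T1 : `|(chebyshevU R k.+1).[y] - y * (chebyshevU R k).[y]| <= 1.
  rewrite -(expr_le1 (n := 2))// -normrX ger0_norm ?sqr_ge0//.
  rewrite -[leRHS](pell k) lerDl mulr_ge0 ?sqr_ge0//; nra.
rewrite -[X in `|X|](subrK (y * (chebyshevU R k).[y])) (le_trans (ler_normD _ _))//.
rewrite -natr1 [leRHS]addrC lerD// normrM (le_trans _ IHk)// ler_piMl//.
by rewrite ler_norml.
Qed.

(** Below 1 both sides are compared with U_k(1) = k + 1; above 1 the polynomial is nonnegative and
    increasing. *)
Lemma chebyshevU_max y x k : 1 <= x -> 0 <= y <= x ->
  `|(chebyshevU R k).[y]| <= (chebyshevU R k).[x].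
Proof.
move=> x1 /andP[y0 yx]; have [y1|/ltW y1] := leP y 1.
  by rewrite (le_trans _ (chebyshevU_ge k x1))// chebyshevU_le// ger0_norm.
by have [U0 Uyx _ _] := chebyshevU_homo_ge1 k y1 yx; rewrite ger0_norm.
Qed.

End ChebyshevBound.

Section Compositions.
Variable R : comNzRingType.

(** Generating functions: expanding the n-th power gives one monomial per function k, of degree the
    sum of its values, and the coefficient of degree m selects the compositions. *)
Lemma sum_compositions (a : nat -> R) (m n : nat) :
  \sum_(k in compositions m n) \prod_(i < n) a (k i) =
  ((\poly_(j < m.+1) a j) ^+ n)`_m.
Proof.
rewrite poly_def -[n in RHS]card_ord -prodr_const bigA_distr_bigA coef_sum big_mkcond/=.
apply: eq_bigr => k _.
rewrite scaler_prod -expr_sum coefZ coefXn inE eq_sym.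
by case: eqP; rewrite ?mulr1 ?mulr0.
Qed.

(** Reconciles the truncation at t - n required by [sum_compositions], which varies with n, with the
    single polynomial truncated at t used in the renewal argument. *)
Lemma coef_exp_trunc (p q : {poly R}) (m n : nat) :
  (forall j, (j <= m)%N -> p`_j = q`_j) -> (p ^+ n)`_m = (q ^+ n)`_m.
Proof.
move=> pq; suff: forall j, (j <= m)%N -> (p ^+ n)`_j = (q ^+ n)`_j by exact.
elim: n => [|n IHn] j jm; first by rewrite !expr0.
rewrite !exprS !coefM; apply: eq_bigr => -[i /= ij] _.
by rewrite pq ?IHn// ?(leq_trans _ jm)// leq_subr.
Qed.

(** The series q = p / (1 - s p X) satisfies q = p + s X p q. The identity compares the coefficients
    of degree t in s X p q = q - p, the factor X being the time step consumed by one cut. *)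
Lemma renewal_coef (p : {poly R}) (s : R) (t : nat) :
  \sum_(i < t) p`_(t.-1 - i) *
     (s * \sum_(0 <= n < i.+1) s ^+ n * (p ^+ n.+1)`_(i - n)) =
  \sum_(1 <= n < t.+1) s ^+ n * (p ^+ n.+1)`_(t - n).
Proof.
case: t => [|t]; first by rewrite big_ord0 big_geq.
rewrite big_add1/=.
(* A truncated geometric series; the terms with n > t contribute nothing in degrees up to t. *)
pose q := \sum_(0 <= n < t.+1) s ^+ n *: (p ^+ n.+1 * 'X^n).
have qE i : (i < t.+1)%N -> q`_i = \sum_(0 <= n < i.+1) s ^+ n * (p ^+ n.+1)`_(i - n).
  move=> it; rewrite coef_sum (@big_cat_nat _ _ _ i.+1)//= [X in _ + X]big_nat_cond.
  rewrite [X in _ + X]big1 ?addr0; last first.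
    by move=> n /andP[/andP[im _] _]; rewrite coefZ coefMXn im mulr0.
  rewrite big_nat_cond [RHS]big_nat_cond; apply: eq_bigr => n /andP[/andP[_ ni] _].
  by rewrite coefZ coefMXn ltnNge -ltnS ni.
under eq_bigr => i _ do rewrite -qE// mulrCA.
rewrite -mulr_sumr.
transitivity (s * (p * q)`_t).
  by rewrite coefMr.
rewrite -coefZ mulr_sumr scaler_sumr coef_sum.
apply: eq_big_nat => n /andP[_ nt].
rewrite -scalerAr scalerA -exprS coefZ mulrA -exprS coefMXn subSS.
by rewrite ltnNge -ltnS nt.
Qed.

End Compositions.

(** * Independence *)

Section IntegralAgainstIndependent.
Local Open Scope ereal_scope.
Context d d' (T : measurableType d) (T' : measurableType d') (R : realType).
Variables (P : probability T R) (X : {mfun T >-> T'}).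
Import HBNNSimple.

(** The integral is split over the fibres of the simple function [h], on each of which the
    hypothesis applies. The constant [c] is left abstract; it will be an expectation times the
    probability of [D]. *)
Lemma ge0_integral_indep_nnsfun (D : set T) (V : T -> R) (c : \bar R)
    (h : {nnsfun T' >-> R}) :
  measurable D -> measurable_fun setT V -> (forall x, (0 <= V x)%R) -> 0 <= c ->
  (forall B, measurable B ->
     \int[P]_(x in D `&` X @^-1` B) (V x)%:E = c * P (X @^-1` B)) ->
  \int[P]_(x in D) (V x * h (X x))%:E = c * \int[P]_x (h (X x))%:E.
Proof.
move=> mD mV V0 c0 DV.
have mXh r : measurable (X @^-1` (h @^-1` [set r])).
  rewrite -[X in measurable X]setTI; exact: measurable_funPT.
(* Stated for any weight [W], so that W = 1 also expands the integral on the right-hand side. *)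
have key (W : T -> R) E : measurable E -> measurable_fun setT W ->
    (forall x, (0 <= W x)%R) ->
  \int[P]_(x in E) (W x * h (X x))%:E =
  \sum_(y \in range h) y%:E *
     \int[P]_(x in E `&` X @^-1` (h @^-1` [set y])) (W x)%:E.
  move=> mE mW W0.
  have eqi x : (W x * h (X x))%:E =
     \sum_(y \in range h) (y * (W x * \1_(X @^-1` (h @^-1` [set y])) x))%:E.
    rewrite {1}(fimfunE h (X x)) mulr_fsumr// -fsumEFin//.
    by apply: eq_fsbigr => y _; rewrite mulrCA.
  under eq_integral do rewrite eqi.
  rewrite ge0_integral_fsum//; last 2 first.
  - move=> y; apply/measurable_EFinP; apply: measurable_funM => //.
    apply: measurable_funM; first exact: measurable_funTS.
    exact: measurable_indic.
  - move=> y x _; rewrite lee_fin mulrCA mulr_ge0//.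
    exact: (nnfun_muleindic_ge0 h y (X x)).
  apply: eq_fsbigr => y; rewrite inE => -[z _ <-].
  under eq_integral do rewrite EFinM.
  rewrite ge0_integralZl_EFin//; last 2 first.
  - by move=> x _; rewrite lee_fin mulr_ge0.
  - apply/measurable_EFinP; apply: measurable_funM; first exact: measurable_funTS.
    exact: measurable_indic.
  congr (_ * _).
  rewrite integral_mkcondr; apply: eq_integral => x _.
  by rewrite epatch_indic EFinM.
rewrite key//.
transitivity (c * \int[P]_x (1 * h (X x))%:E); last first.
  by congr (_ * _); apply: eq_integral => x _; rewrite mul1r.
rewrite (key (cst 1%R))// ge0_mule_fsumr; last first.
  (* The summands must be nonnegative for every real y; a negative y is not a value of [h], so its
     fibre is empty. *)
  move=> y; case: (leP 0%R y) => y0.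
    by rewrite mule_ge0 ?lee_fin// integral_ge0.
  rewrite [X in \int[P]_(x in X) _](_ : _ = set0) ?integral_set0 ?mule0//.
  apply/seteqP; split => // x [_] /= hy.
  by move: y0; rewrite -hy ltNge fun_ge0.
apply: eq_fsbigr => y _.
rewrite DV// setTI muleCA; congr (_ * (_ * _)).
by rewrite -[LHS]mul1e -integral_cst.
Qed.

(** Monotone convergence along simple functions increasing to [h]. Finiteness of [c] lets
    multiplication by [c] pass to the limit. *)
Lemma ge0_integral_indep (D : set T) (V : T -> R) (c : \bar R) (h : T' -> R) :
  measurable D -> measurable_fun setT V -> (forall x, (0 <= V x)%R) ->
  0 <= c -> c \is a fin_num ->
  measurable_fun setT h -> (forall y, (0 <= h y)%R) ->
  (forall B, measurable B ->
     \int[P]_(x in D `&` X @^-1` B) (V x)%:E = c * P (X @^-1` B)) ->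
  \int[P]_(x in D) (V x * h (X x))%:E = c * \int[P]_x (h (X x))%:E.
Proof.
move=> mD mV V0 c0 cfin mh h0 DV.
have mEh : measurable_fun setT (EFin \o h) by exact/measurable_EFinP.
pose g := nnsfun_approx measurableT mEh.
have mgX n : measurable_fun setT (g n \o X) by exact: measurableT_comp.
have nd_g x m n : (m <= n)%N -> (g m x <= g n x)%R.
  by move=> mn; exact/lefP/nd_nnsfun_approx.
have gh y : (g n y)%:E @[n --> \oo] --> (h y)%:E.
  by apply: (@cvg_nnsfun_approx _ _ _ _ measurableT _ mEh) => // x _; rewrite lee_fin.
have key (W : T -> R) E : measurable E -> measurable_fun setT W ->
    (forall x, (0 <= W x)%R) ->
  \int[P]_(x in E) (W x * g n (X x))%:E @[n --> \oo] -->
  \int[P]_(x in E) (W x * h (X x))%:E.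
  move=> mE mW W0.
  have -> : \int[P]_(x in E) (W x * h (X x))%:E =
      \int[P]_(x in E) limn (fun n => (W x * g n (X x))%:E).
    apply: eq_integral => x _; apply/esym/cvg_lim => //.
    under eq_fun do rewrite EFinM.
    by rewrite EFinM; apply: cvgeZl => //; exact: gh.
  apply: cvg_monotone_convergence => //.
  - move=> n; apply/measurable_EFinP/measurable_funTS.
    by apply: measurable_funM => //; exact: mgX.
  - by move=> n x _; rewrite lee_fin mulr_ge0.
  - by move=> x _ m n mn; rewrite lee_fin ler_wpM2l// nd_g.
have /cvg_lim <-// := key V D mD mV V0.
have : \int[P]_x (g n (X x))%:E @[n --> \oo] --> \int[P]_x (h (X x))%:E.
  have := key (cst 1%R) setT measurableT (measurable_cst _) (fun _ => ler01).
  under eq_fun => n do under eq_integral do rewrite mul1r.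
  by under [X in _ --> X]eq_integral do rewrite mul1r.
move=> /(cvgeZl cfin) /cvg_lim <-//; congr (limn _).
by apply/funext => n; exact: ge0_integral_indep_nnsfun.
Qed.

End IntegralAgainstIndependent.

Section IndependentFrom.
Context d d' (T : measurableType d) (T' : measurableType d') (R : realType).
Variables (P : probability T R) (X : nat -> {RV P >-> T'}).
Hypothesis X_indep : mutually_independent X.

Local Notation Ex W := (fine 'E_P[W]%E).

(* A weak form of independence of [V] from [(X s)_(s >= t)] that, unlike
   independence itself, is preserved by sums. This handles polynomials in the
   entries of [X 0, ..., X (t - 1)] without any generated sigma-algebra. *)
Definition ge0_indep_from (t : nat) (V : T -> R) : Prop :=
  [/\ forall x, 0 <= V x, V \in Lfun P 1 &
      forall (J : seq nat) (B : nat -> set T'), uniq J ->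
        (forall s, s \in J -> (t <= s)%N) ->
        (forall s, s \in J -> measurable (B s)) ->
        (\int[P]_(x in \bigcap_(s in [set` J]) (X s @^-1` B s)) (V x)%:E =
         'E_P[V] * P (\bigcap_(s in [set` J]) (X s @^-1` B s)))%E].

(** Nonnegative pieces allow monotone convergence, and differences restore stability under negative
    scalars. Any decomposition is accepted, because positive and negative parts would not be
    additive in [W]. *)
Definition indep_from (t : nat) (W : T -> R) : Prop :=
  exists V1 V2, [/\ ge0_indep_from t V1, ge0_indep_from t V2 & W = V1 \- V2].

Lemma measurable_bigcap_preimage (J : seq nat) (B : nat -> set T') :
  (forall s, s \in J -> measurable (B s)) ->
  measurable (\bigcap_(s in [set` J]) (X s @^-1` B s)).
Proof.
move=> mB; apply: bigcap_measurableType => s Js.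
by rewrite -[X in measurable X]setTI; apply: measurable_funPT => //; exact: mB.
Qed.

Lemma ge0_indep_fromS t V : ge0_indep_from t V -> ge0_indep_from t.+1 V.
Proof.
by move=> [V0 V1 VJ]; split=> // J B uJ tJ mB; apply: VJ => // s /tJ /ltnW.
Qed.

Lemma ge0_indep_fromD t V1 V2 :
  ge0_indep_from t V1 -> ge0_indep_from t V2 -> ge0_indep_from t (V1 \+ V2).
Proof.
move=> [V10 L1 VJ1] [V20 L2 VJ2]; split; first by move=> x; rewrite addr_ge0.
  by rewrite rpredD.
move=> J B uJ tJ mB; have mD := measurable_bigcap_preimage mB.
rewrite expectationD// ge0_muleDl; [|by apply: expectation_ge0..].
rewrite -VJ1// -VJ2//; under eq_integral do rewrite /= EFinD.
have mV W : W \in Lfun P 1 -> measurable_fun setT (EFin \o W).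
  by move/Lfun1_integrable; exact: measurable_int.
rewrite ge0_integralD//; try by move=> x _; rewrite lee_fin.
all: by apply: measurable_funTS; exact: mV.
Qed.

Lemma ge0_indep_fromZ t (k : R) V : 0 <= k ->
  ge0_indep_from t V -> ge0_indep_from t (k \o* V).
Proof.
move=> k0 [V0 L1 VJ]; split; first by move=> x; rewrite mulr_ge0.
  by rewrite (_ : _ \o* _ = k *: V) ?rpredZ//; apply/funext => x; rewrite /= mulrC.
move=> J B uJ tJ mB; have mD := measurable_bigcap_preimage mB.
rewrite expectationZl// -muleA -VJ//.
under eq_integral do rewrite /= mulrC EFinM.
rewrite ge0_integralZl_EFin//; first by move=> x _; rewrite lee_fin.
by apply: measurable_funTS; move/Lfun1_integrable: L1; exact: measurable_int.
Qed.

Lemma ge0_indep_from_cst t (k : R) : 0 <= k -> ge0_indep_from t (cst k).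
Proof.
move=> k0; split => //; first exact: Lfun_cst.
move=> J B uJ tJ mB; have mD := measurable_bigcap_preimage mB.
by rewrite expectation_cst -integral_cst.
Qed.

(** An event on times after t, intersected with one on [X t], is again an event on times from t on,
    so the property of [V] applies to it; mutual independence then splits off the probability of the
    event on [X t]. *)
Lemma ge0_indep_fromM t V (h : T' -> R) : ge0_indep_from t V ->
  measurable_fun setT h -> (forall y, 0 <= h y) -> h \o X t \in Lfun P 1 ->
  ge0_indep_from t.+1 (V \* (h \o X t)) /\
  'E_P[V \* (h \o X t)]%E = ('E_P[V] * 'E_P[h \o X t])%E.
Proof.
move=> [V0 L1 VJ] mh h0 Lh.
have mV : measurable_fun setT V.
  by apply/measurable_EFinP; move/Lfun1_integrable: L1; exact: measurable_int.
have main (J : seq nat) (B : nat -> set T') : uniq J ->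
    (forall s, s \in J -> (t < s)%N) ->
    (forall s, s \in J -> measurable (B s)) ->
  (\int[P]_(x in \bigcap_(s in [set` J]) (X s @^-1` B s)) (V x * h (X t x))%:E =
   'E_P[V] * P (\bigcap_(s in [set` J]) (X s @^-1` B s)) * 'E_P[h \o X t])%E.
  move=> uJ tJ mB; have mD := measurable_bigcap_preimage mB.
  have -> : ('E_P[h \o X t] = \int[P]_x (h (X t x))%:E)%E by rewrite unlock.
  apply: ge0_integral_indep => //.
  - by rewrite mule_ge0//; apply: expectation_ge0.
  - by rewrite fin_numM ?expectation_fin_num ?fin_num_measure.
  (* [B'] adds the constraint [C] at time t to the family; t is not in [J], so no earlier constraint
     is overwritten. *)
  move=> C mC; pose B' s := if s == t then C else B s.
  have ntJ : t \notin J by apply/negP => /tJ; rewrite ltnn.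
  have uJ' : uniq (t :: J) by rewrite /= ntJ.
  have B'J s : s \in J -> B' s = B s.
    by rewrite /B'; case: eqP => // -> tJ'; rewrite tJ' in ntJ.
  have B't : B' t = C by rewrite /B' eqxx.
  have mB' s : s \in t :: J -> measurable (B' s).
    by rewrite inE /B'; case: eqP => //= _ /mB.
  have DE : \bigcap_(s in [set` J]) (X s @^-1` B s) =
            \bigcap_(s in [set` J]) (X s @^-1` B' s).
    by apply: eq_bigcapr => s Js; rewrite B'J.
  have DtE : \bigcap_(s in [set` J]) (X s @^-1` B s) `&` X t @^-1` C =
            \bigcap_(s in [set` t :: J]) (X s @^-1` B' s).
    by rewrite DE !bigcap_seq big_cons setIC B't.
  rewrite DtE VJ//; last by move=> s; rewrite inE => /predU1P[->//|/tJ/ltnW].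
  rewrite !X_indep// big_cons B't -muleA; congr (_ * _)%E.
  rewrite muleC; congr (_ * _)%E.
  by rewrite big_seq [RHS]big_seq; apply: eq_bigr => s /B'J ->.
have EM : 'E_P[V \* (h \o X t)]%E = ('E_P[V] * 'E_P[h \o X t])%E.
  (* With no constraint at all the event is the whole space, of probability 1. *)
  have := main [::] (fun=> setT) isT; rewrite bigcap_seq big_nil probability_setT mule1.
  by move=> <-//; rewrite unlock.
have mVh : measurable_fun setT (V \* (h \o X t)).
  by apply: measurable_funM => //; exact: measurableT_comp.
split=> //; split; first by move=> x; rewrite mulr_ge0 /=.
  apply/Lfun1_integrable/integrableP; split; first exact/measurable_EFinP.
  under eq_integral do rewrite gee0_abs ?lee_fin ?mulr_ge0//=.
  have := EM; rewrite [in LHS]unlock => ->.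
  by rewrite ltey_eq fin_numM ?expectation_fin_num.
by move=> J B uJ tJ mB; rewrite main// EM -!muleA [X in (_ * X)%E]muleC.
Qed.

Lemma indep_from_Lfun t W : indep_from t W -> W \in Lfun P 1.
Proof. by move=> [V1 [V2 [[_ L1 _] [_ L2 _] ->]]]; rewrite rpredB. Qed.

Lemma ge0_indep_from_indep_from t V : ge0_indep_from t V -> indep_from t V.
Proof.
move=> tV; exists V, (cst 0); split => //; first exact: ge0_indep_from_cst.
by apply/funext => x /=; rewrite subr0.
Qed.

Lemma indep_fromS t W : indep_from t W -> indep_from t.+1 W.
Proof. by move=> [V1 [V2 [t1 t2 ->]]]; exists V1, V2; split=> //; exact: ge0_indep_fromS. Qed.

Lemma indep_fromD t W1 W2 :
  indep_from t W1 -> indep_from t W2 -> indep_from t (W1 \+ W2).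
Proof.
move=> [V1 [V2 [tV1 tV2 ->]]] [U1 [U2 [tU1 tU2 ->]]].
exists (V1 \+ U1), (V2 \+ U2); split; [exact: ge0_indep_fromD..|].
by apply/funext => x /=; ring.
Qed.

Lemma indep_fromZ t (k : R) W : indep_from t W -> indep_from t (k \o* W).
Proof.
move=> [V1 [V2 [tV1 tV2 ->]]]; have [k0|/ltW k0] := leP 0 k.
  exists (k \o* V1), (k \o* V2); split; [exact: ge0_indep_fromZ..|].
  by apply/funext => x /=; ring.
have Nk0 : 0 <= - k by rewrite oppr_ge0.
exists (- k \o* V2), (- k \o* V1); split; [exact: ge0_indep_fromZ..|].
by apply/funext => x /=; ring.
Qed.

Lemma indep_from_cst t (k : R) : indep_from t (cst k).
Proof.
rewrite (_ : cst k = k \o* cst 1); last by apply/funext => x /=; rewrite mul1r.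
exact/indep_fromZ/ge0_indep_from_indep_from/ge0_indep_from_cst.
Qed.

Lemma indep_from_sum t (I : finType) (W : I -> T -> R) :
  (forall i, indep_from t (W i)) -> indep_from t (fun x => \sum_i W i x).
Proof.
move=> tW; rewrite -[X in indep_from t X](_ : \sum_i W i = _); last first.
  by apply/funext => x; rewrite fct_sumE.
by elim/big_rec : _ => [|i V _ tV]; [exact: indep_from_cst|exact: indep_fromD].
Qed.

(** Splitting [h] as well gives four nonnegative products, regrouped by sign into the two pieces of
    the result. This product rule takes the place of conditioning on the past. *)
Lemma indep_fromM t W (h : T' -> R) : indep_from t W ->
  measurable_fun setT h -> h \o X t \in Lfun P 1 ->
  indep_from t.+1 (W \* (h \o X t)) /\
  Ex (W \* (h \o X t)) = Ex W * Ex (h \o X t).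
Proof.
move=> [V1 [V2 [tV1 tV2 ->]]] mh Lh.
have Lp : h^\+ \o X t \in Lfun P 1.
  by apply/Lfun1_integrable; exact/integrable_funrpos/Lfun1_integrable.
have Ln : h^\- \o X t \in Lfun P 1.
  by apply/Lfun1_integrable; exact/integrable_funrneg/Lfun1_integrable.
have mp := measurable_funrpos mh; have mn := measurable_funrneg mh.
have p0 := funrpos_ge0 h; have n0 := funrneg_ge0 h.
have [[t1p E1p] [t1n E1n]] := (ge0_indep_fromM tV1 mp p0 Lp, ge0_indep_fromM tV1 mn n0 Ln).
have [[t2p E2p] [t2n E2n]] := (ge0_indep_fromM tV2 mp p0 Lp, ge0_indep_fromM tV2 mn n0 Ln).
have hE : h \o X t = (h^\+ \o X t) \- (h^\- \o X t).
  by rewrite -[in LHS](funrposBneg h).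
have WE : (V1 \- V2) \* (h \o X t) =
    (V1 \* (h^\+ \o X t) \+ V2 \* (h^\- \o X t)) \-
    (V1 \* (h^\- \o X t) \+ V2 \* (h^\+ \o X t)).
  by rewrite hE; apply/funext => x /=; ring.
have [tp tn] := (ge0_indep_fromD t1p t2n, ge0_indep_fromD t1n t2p).
split; first by rewrite WE; do 2 eexists; split; [exact: tp|exact: tn|].
have L V s : ge0_indep_from s V -> V \in Lfun P 1 by case.
rewrite WE !expectationB ?expectationD ?(L _ _ tp) ?(L _ _ tn) ?(L _ _ t1p)
  ?(L _ _ t1n) ?(L _ _ t2p) ?(L _ _ t2n) ?(L _ _ tV1) ?(L _ _ tV2)//.
rewrite hE expectationB// E1p E1n E2p E2n.
have fE V : V \in Lfun P 1 -> exists r, 'E_P[V]%E = r%:E.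
  by move/expectation_fin_num/fineK => <-; eexists.
have [[a ->] [b ->]] := (fE _ (L _ _ tV1), fE _ (L _ _ tV2)).
have [[p ->] [n ->]] := (fE _ Lp, fE _ Ln).
by rewrite -!EFinM -!EFinD /=; ring.
Qed.

End IndependentFrom.

(** * The spectral norm *)

Section SpectralNorm.
Variable R : realType.

Lemma l2norm_ge0 n (v : 'cV[R]_n) : 0 <= l2norm v.
Proof. exact: sqrtr_ge0. Qed.

Lemma sqr_l2norm n (v : 'cV[R]_n) : l2norm v ^+ 2 = \sum_i v i 0 ^+ 2.
Proof. by rewrite sqr_sqrtr// sumr_ge0// => i _; exact: sqr_ge0. Qed.

Lemma l2norm_eq0 n (v : 'cV[R]_n) : l2norm v = 0 -> v = 0.
Proof.
move=> v0; have : l2norm v ^+ 2 = 0 by rewrite v0 expr0n.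
rewrite sqr_l2norm => /psumr_eq0P v2; apply/colP => i; rewrite mxE.
by apply/eqP; rewrite -sqrf_eq0; apply/eqP/v2 => // j _; exact: sqr_ge0.
Qed.

Lemma l2normZ n (k : R) (v : 'cV[R]_n) : l2norm (k *: v) = `|k| * l2norm v.
Proof.
apply/eqP; rewrite -(@eqrXn2 _ 2)// ?mulr_ge0 ?l2norm_ge0//.
rewrite exprMn !sqr_l2norm real_normK ?num_real// mulr_sumr; apply/eqP.
by apply: eq_bigr => i _; rewrite mxE exprMn.
Qed.

(** The nonnegative sum of the squares (x b_i - p a_i)^2 equals x (x y - p^2); dividing by x
    requires the case x = 0 to be treated apart. *)
Lemma Cauchy_Schwarz_sum (I : finType) (a b : I -> R) :
  (\sum_i a i * b i) ^+ 2 <= (\sum_i a i ^+ 2) * (\sum_i b i ^+ 2).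
Proof.
have expand x p : \sum_i (x * b i - p * a i) ^+ 2 = x ^+ 2 * (\sum_i b i ^+ 2) -
    2 * x * p * (\sum_i a i * b i) + p ^+ 2 * (\sum_i a i ^+ 2).
  rewrite !mulr_sumr -sumrB -big_split.
  by apply: eq_bigr => i _ /=; ring.
set p := \sum_i a i * b i; set x := \sum_i a i ^+ 2; set y := \sum_i b i ^+ 2.
have x0 : 0 <= x by apply: sumr_ge0 => i _; exact: sqr_ge0.
have [x_eq0|xn0] := eqVneq x 0.
  have a0 i : a i = 0.
    move/psumr_eq0P : x_eq0 => /(_ (fun j _ => sqr_ge0 (a j)) i isT)/eqP.
    by rewrite sqrf_eq0 => /eqP.
  by rewrite x_eq0 mul0r /p big1 ?expr0n// => i _; rewrite a0 mul0r.
have : 0 <= \sum_i (x * b i - p * a i) ^+ 2 by apply: sumr_ge0 => i _; exact: sqr_ge0.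
rewrite expand -/x -/y -/p => h.
have xp : 0 < x by rewrite lt_def xn0.
rewrite -subr_ge0 -(pmulr_rge0 _ xp) (le_trans h)//.
by rewrite le_eqVlt; apply/orP; left; apply/eqP; ring.
Qed.

Lemma ler_l2normD n (u v : 'cV[R]_n) : l2norm (u + v) <= l2norm u + l2norm v.
Proof.
rewrite -(ler_pXn2r (n := 2))// ?nnegrE ?addr_ge0 ?l2norm_ge0//.
rewrite sqrrD !sqr_l2norm.
under eq_bigr do rewrite mxE sqrrD.
rewrite !big_split /= lerD2r lerD2l mulr2n.
suff uv : \sum_i u i 0 * v i 0 <= l2norm u * l2norm v by rewrite lerD.
rewrite (le_trans (ler_norm _))//.
rewrite -(ler_pXn2r (n := 2))// ?nnegrE ?mulr_ge0 ?l2norm_ge0//.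
by rewrite exprMn !sqr_l2norm real_normK ?num_real// Cauchy_Schwarz_sum.
Qed.

Lemma spectral_norm_has_ubound m n (M : 'M[R]_(m, n)) :
  has_ubound [set l2norm (M *m v) | v in [set v : 'cV[R]_n | l2norm v <= 1]].
Proof.
(* The bound is the Frobenius norm, by Cauchy-Schwarz on each row. *)
exists (Num.sqrt (\sum_i \sum_j M i j ^+ 2)) => _ [v /= v1 <-].
rewrite ler_wsqrtr//; apply: ler_sum => i _; rewrite mxE.
rewrite (le_trans (Cauchy_Schwarz_sum _ _))// ler_piMr//.
  by apply: sumr_ge0 => j _; exact: sqr_ge0.
by rewrite -sqr_l2norm expr_le1 ?l2norm_ge0.
Qed.

Lemma l2norm0 n : l2norm (0 : 'cV[R]_n) = 0.
Proof. by rewrite -(scale0r 0) l2normZ normr0 mul0r. Qed.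

Lemma spectral_norm_ge0 m n (M : 'M[R]_(m, n)) : 0 <= spectral_norm M.
Proof.
apply: (ub_le_sup (spectral_norm_has_ubound M)).
by exists 0; rewrite /= ?mulmx0 l2norm0 ?ler01.
Qed.

Lemma l2norm_mulmx m n (M : 'M[R]_(m, n)) v :
  l2norm (M *m v) <= spectral_norm M * l2norm v.
Proof.
have [/l2norm_eq0 ->|vn0] := eqVneq (l2norm v) 0.
  by rewrite mulmx0 !l2norm0 mulr0.
have v0 : 0 < l2norm v by rewrite lt_def vn0 l2norm_ge0.
rewrite -ler_pdivrMr//; apply: (ub_le_sup (spectral_norm_has_ubound M)).
exists ((l2norm v)^-1 *: v) => /=.
  by rewrite l2normZ ger0_norm ?invr_ge0 ?l2norm_ge0// mulVf.
by rewrite -scalemxAr l2normZ ger0_norm ?invr_ge0 ?l2norm_ge0// mulrC.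
Qed.

Lemma spectral_norm_le m n (M : 'M[R]_(m, n)) c : 0 <= c ->
  (forall v, l2norm (M *m v) <= c * l2norm v) -> spectral_norm M <= c.
Proof.
move=> c0 Mc; apply: ge_sup.
  by exists (l2norm (M *m 0)), 0; rewrite //= l2norm0 ler01.
by move=> _ [v /= v1 <-]; rewrite (le_trans (Mc v))// ler_piMr.
Qed.

Lemma spectral_normM m n p (M : 'M[R]_(m, n)) (N : 'M[R]_(n, p)) :
  spectral_norm (M *m N) <= spectral_norm M * spectral_norm N.
Proof.
apply: spectral_norm_le => [|v]; first by rewrite mulr_ge0 ?spectral_norm_ge0.
rewrite -mulmxA (le_trans (l2norm_mulmx _ _))// -mulrA.
by rewrite ler_wpM2l ?spectral_norm_ge0 ?l2norm_mulmx.
Qed.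

Lemma spectral_normD m n (M N : 'M[R]_(m, n)) :
  spectral_norm (M + N) <= spectral_norm M + spectral_norm N.
Proof.
apply: spectral_norm_le => [|v]; first by rewrite addr_ge0 ?spectral_norm_ge0.
by rewrite mulmxDl (le_trans (ler_l2normD _ _))// mulrDl lerD ?l2norm_mulmx.
Qed.

Lemma spectral_norm0 m n : spectral_norm (0 : 'M[R]_(m, n)) = 0.
Proof.
apply/le_anti; rewrite spectral_norm_ge0 andbT.
by apply: spectral_norm_le => // v; rewrite mul0mx l2norm0 mul0r.
Qed.

Lemma spectral_norm_sum (I : Type) (r : seq I) m n (M : I -> 'M[R]_(m, n)) :
  spectral_norm (\sum_(i <- r) M i) <= \sum_(i <- r) spectral_norm (M i).
Proof.
elim: r => [|i r IHr]; first by rewrite !big_nil spectral_norm0.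
by rewrite !big_cons (le_trans (spectral_normD _ _))// lerD2l.
Qed.

Lemma sum_mxtens (V : nmodType) m n (F : 'I_m -> 'I_n -> V) :
  \sum_i \sum_j F i j =
  \sum_(k < m * n) F (mxtens_unindex k).1 (mxtens_unindex k).2.
Proof.
rewrite pair_big (reindex (@mxtens_unindex m n))/=; last first.
  by exists (@mxtens_index m n) => k _; rewrite ?mxtens_indexK ?mxtens_unindexK.
by [].
Qed.

(** For each fixed second index j, the matrix acts as [M] on the slice of [v] with that index, and
    the squared norm of a vector is the sum of those of its slices. *)
Lemma spectral_norm_tensmx1 m n p (M : 'M[R]_(m, n)) :
  spectral_norm (M *t (1%:M : 'M[R]_p)) <= spectral_norm M.
Proof.
apply: spectral_norm_le => [|v]; first exact: spectral_norm_ge0.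
rewrite -(ler_pXn2r (n := 2))// ?nnegrE ?mulr_ge0 ?spectral_norm_ge0 ?l2norm_ge0//.
pose slice j : 'cV[R]_n := \col_i v (mxtens_index (i, j)) 0.
have sliceE (q : nat) (u : 'cV[R]_(q * p)) : l2norm u ^+ 2 =
    \sum_j l2norm (\col_i u (mxtens_index (i, j)) 0) ^+ 2.
  rewrite sqr_l2norm; under [RHS]eq_bigr do rewrite sqr_l2norm.
  rewrite exchange_big sum_mxtens; apply: eq_bigr => k _.
  by rewrite mxE -surjective_pairing mxtens_unindexK.
rewrite exprMn !sliceE mulr_sumr; apply: ler_sum => j _.
rewrite -/(slice j) -exprMn ler_pXn2r// ?nnegrE ?mulr_ge0 ?spectral_norm_ge0 ?l2norm_ge0//.
suff -> : \col_i ((M *t 1%:M) *m v) (mxtens_index (i, j)) 0 = M *m slice j.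
  exact: l2norm_mulmx.
apply/colP => i; rewrite !mxE -(mxtens_unindexK (mxtens_index (i, j))).
transitivity (\sum_k \sum_l (M i k * (j == l)%:R * v (mxtens_index (k, l)) 0)).
  rewrite sum_mxtens; apply: eq_bigr => k _.
  by rewrite !mxE !mxtens_indexK -surjective_pairing mxtens_unindexK.
apply: eq_bigr => k _; rewrite (bigD1 j)//= eqxx mulr1 big1 ?addr0 ?mxE// => l lj.
by rewrite eq_sym (negbTE lj) mulr0 mul0r.
Qed.

End SpectralNorm.

Section SpectralNormTensor.
Variable R : realType.
Lemma spectral_norm_tens1mx m n p (M : 'M[R]_(m, n)) :
  spectral_norm ((1%:M : 'M[R]_p) *t M) <= spectral_norm M.
Proof.
apply: spectral_norm_le => [|v]; first exact: spectral_norm_ge0.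
rewrite -(ler_pXn2r (n := 2))// ?nnegrE ?mulr_ge0 ?spectral_norm_ge0 ?l2norm_ge0//.
pose slice i : 'cV[R]_n := \col_j v (mxtens_index (i, j)) 0.
have sliceE (q : nat) (u : 'cV[R]_(p * q)) : l2norm u ^+ 2 =
    \sum_i l2norm (\col_j u (mxtens_index (i, j)) 0) ^+ 2.
  rewrite sqr_l2norm; under [RHS]eq_bigr do rewrite sqr_l2norm.
  rewrite sum_mxtens; apply: eq_bigr => k _.
  by rewrite mxE -surjective_pairing mxtens_unindexK.
rewrite exprMn !sliceE mulr_sumr; apply: ler_sum => i _.
rewrite -/(slice i) -exprMn ler_pXn2r// ?nnegrE ?mulr_ge0 ?spectral_norm_ge0 ?l2norm_ge0//.
suff -> : \col_j ((1%:M *t M) *m v) (mxtens_index (i, j)) 0 = M *m slice i.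
  exact: l2norm_mulmx.
apply/colP => j; rewrite !mxE -(mxtens_unindexK (mxtens_index (i, j))).
transitivity (\sum_k \sum_l ((i == k)%:R * M j l * v (mxtens_index (k, l)) 0)).
  rewrite sum_mxtens; apply: eq_bigr => k _.
  by rewrite !mxE !mxtens_indexK -surjective_pairing mxtens_unindexK.
rewrite (bigD1 i)//= [X in _ + X]big1 ?addr0; last first.
  by move=> k ki; rewrite big1// => l _; rewrite eq_sym (negbTE ki) !mul0r.
by apply: eq_bigr => l _; rewrite eqxx mul1r mxE.
Qed.

Lemma spectral_norm_tensmx m n (M : 'M[R]_m) (N : 'M[R]_n) :
  spectral_norm (M *t N) <= spectral_norm M * spectral_norm N.
Proof.
rewrite tensmx_decr (le_trans (spectral_normM _ _))// ler_pM ?spectral_norm_ge0//.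
  exact: spectral_norm_tensmx1.
exact: spectral_norm_tens1mx.
Qed.
End SpectralNormTensor.

(** * Algebra of simultaneously diagonalized matrices *)

Section ConjDiag.
Variables (K : fieldType) (n : nat) (U : 'M[K]_n).

(** With [U] fixed, products and linear combinations act entrywise on [D], which turns the matrix
    recursion into one scalar recursion per eigenvalue. *)
Definition conj_diag (D : 'rV[K]_n) : 'M[K]_n := invmx U *m diag_mx D *m U.

Lemma conj_diagM D E : U \in unitmx ->
  conj_diag D *m conj_diag E = conj_diag (\row_i (D 0 i * E 0 i)).
Proof.
move=> Uu; rewrite /conj_diag mulmxA mulmxA mulmxK//.
by rewrite -[_ *m diag_mx D *m diag_mx E]mulmxA mulmx_diag.
Qed.

Lemma conj_diagBZ D E k : conj_diag D - k *: conj_diag E = conj_diag (D - k *: E).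
Proof.
rewrite /conj_diag scalemxAl scalemxAr -mulmxBl -mulmxBr; congr (_ *m _ *m _).
by apply/matrixP => i j; rewrite !mxE mulrnBl mulrnAr.
Qed.

Lemma conj_diag1 : U \in unitmx -> conj_diag (const_mx 1) = 1%:M.
Proof. by move=> Uu; rewrite /conj_diag diag_const_mx mulmx1 mulVmx. Qed.
End ConjDiag.

(** * Mean momentum iterates *)

Section MomentumRecursion.
Variables (R : realType) (d : nat) (beta : R) (a : nat -> 'M[R]_d).

(* [momentum_prev a t] is [F_(t-1)], with [F_(-1) = 0]. *)
Definition momentum_prev (t : nat) : 'M[R]_d := (momentum_pair beta a t).2.

Lemma momentum_prevS t : momentum_prev t.+1 = momentum beta a t.
Proof. by rewrite /momentum_prev /momentum /=; case: momentum_pair. Qed.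

Lemma momentumS t :
  momentum beta a t.+1 = a t *m momentum beta a t - beta *: momentum_prev t.
Proof. by rewrite /momentum_prev /momentum /=; case: momentum_pair. Qed.

End MomentumRecursion.

Section SpectralBound.
Local Open Scope sesquilinear_scope.

Lemma sqr_norm_unitary (C : numClosedFieldType) n (U : 'M[C]_n) (v : 'cV[C]_n) :
  U \is unitarymx ->
  \sum_i `|(U *m v) i 0| ^+ 2 = \sum_i `|v i 0| ^+ 2.
Proof.
move=> Uu; have sqE (w : 'cV[C]_n) : \sum_i `|w i 0| ^+ 2 = ((w ^t* ) *m w) 0 0.
  by rewrite mxE; apply: eq_bigr => i _; rewrite !mxE normCKC.
have UU : U ^t* *m U = 1%:M by rewrite -invmx_unitary// mulVmx ?unitarymx_unit.
by rewrite !sqE trmx_mul map_mxM !mulmxA -[X in X *m v]mulmxA UU mulmx1.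
Qed.

Variables (R : realType) (d : nat) (A : 'M[R]_d) (lambda beta : R).
Hypotheses (A_sym : A^T = A) (A_psd : possemidef A).
Hypothesis lambda_largest : largest_eigenvalue A lambda.
Hypotheses (beta_gt0 : 0 < beta) (lambda_beta : 4 * beta <= lambda ^+ 2).

Lemma psd_eigenvalue_ge0 mu : eigenvalue A mu -> 0 <= mu.
Proof.
move=> /eigenvalueP[v vA v0].
have := A_psd v^T; rewrite trmxK vA -scalemxAl mxE.
have vv : (v *m v^T) 0 0 = l2norm v^T ^+ 2.
  by rewrite sqr_l2norm mxE; apply: eq_bigr => i _; rewrite !mxE expr2.
rewrite vv pmulr_lge0// lt_def sqr_ge0 sqrf_eq0 andbT.
apply: contra v0 => /eqP/l2norm_eq0/(congr1 trmx).
by rewrite trmxK trmx0 => ->.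
Qed.

Local Notation toC := (real_complex R).
Let AC := map_mx toC A.
Let U := spectralmx AC.
(** Taking real parts loses nothing: [AC] is Hermitian, so its eigenvalues are real. *)
Let mu i := complex.Re (spectral_diag AC 0 i).

Let U_unit : U \in unitmx. Proof. exact: spectral_unit. Qed.

Let AC_herm : AC \is hermsymmx.
Proof.
apply: realsym_hermsym.
  apply/is_hermitianmxP; rewrite expr0 scale1r map_mx_id//.
  by rewrite map_trmx A_sym.
apply/mxOverP => i j; rewrite mxE; apply/CrealP.
by rewrite conj_Creal// complex_real.
Qed.

Let ACE : AC = invmx U *m diag_mx (\row_i toC (mu i)) *m U.
Proof.
have -> : \row_i toC (mu i) = spectral_diag AC.
  apply/rowP => i; rewrite mxE; apply: RRe_real.
  by have /mxOverP := hermitian_spectral_diag_real AC_herm; apply.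
exact/orthomx_spectralP/hermitian_normalmx.
Qed.

(** The rows of [U] are left eigenvectors of [AC]. The eigenvalue is brought back to the real
    matrix, where positivity and the maximality of [lambda] are available. *)
Let mu_eigen i : eigenvalue A (mu i).
Proof.
rewrite -(eigenvalue_map toC); apply/eigenvalueP; exists (row i U).
  rewrite -row_mul -/AC ACE !mulmxA mulmxV// mul1mx row_mul row_diag_mx.
  by rewrite -scalemxAl -rowE mxE.
apply/eqP; rewrite rowE => /(congr1 (mulmx^~ (invmx U))) /=.
rewrite mulmxK// mul0mx => /matrixP/(_ 0 i).
by rewrite !mxE !eqxx => /eqP; rewrite oner_eq0.
Qed.

Let s := Num.sqrt beta.
(** This is the momentum iterate with [A] replaced by the scalar x: it starts with 1 and x, and the
    rescaling by powers of s turns the Chebyshev recurrence into the momentum recursion. *)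
Let gam k x := s ^+ k * (chebyshevU R k).[x / (2 * s)].

Let s_gt0 : 0 < s. Proof. by rewrite sqrtr_gt0. Qed.

Let gamS k x : gam k.+2 x = x * gam k.+1 x - beta * gam k x.
Proof.
rewrite /gam chebyshevU_recr -[X in _ - X * _](sqr_sqrtr (ltW beta_gt0)) -/s.
by rewrite !exprS; field; rewrite gt_eqF.
Qed.

Let momentumE k : map_mx toC (momentum beta (fun=> A) k) =
  conj_diag U (\row_i toC (gam k (mu i))).
Proof.
suff: map_mx toC (momentum beta (fun=> A) k) = conj_diag U (\row_i toC (gam k (mu i))) /\
  map_mx toC (momentum beta (fun=> A) k.+1) = conj_diag U (\row_i toC (gam k.+1 (mu i))).
  by case.
elim: k => [|k [IH0 IH1]]; split; [| |exact: IH1|].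
- rewrite (_ : \row_i _ = const_mx 1); last first.
    by apply/rowP => i; rewrite !mxE /gam chebyshevU0 expr0 mulr1 rmorph1.
  by rewrite conj_diag1// map_mx1.
- rewrite momentumS mulmx1 scaler0 subr0 -/AC ACE -/(conj_diag U _).
  suff -> : \row_i toC (gam 1 (mu i)) = \row_i toC (mu i) by [].
  apply/rowP => i; rewrite !mxE /gam chebyshevU1; congr (toC _).
  by field; rewrite gt_eqF.
- rewrite momentumS momentum_prevS map_mxB map_mxM map_mxZ IH0 IH1 -/AC ACE -/(conj_diag U _).
  rewrite (conj_diagM _ _ U_unit).
  rewrite conj_diagBZ.
  congr (conj_diag _ _); apply/rowP => i; rewrite !mxE.
  rewrite gamS rmorphB !rmorphM; reflexivity.
Qed.

Lemma spectral_norm_momentum_cst k :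
  spectral_norm (momentum beta (fun=> A) k) <=
  s ^+ k * (chebyshevU R k).[lambda / (2 * s)].
Proof.
have [lambda_eig lambda_max] := lambda_largest.
have lambda0 := psd_eigenvalue_ge0 lambda_eig.
have s2 : s ^+ 2 = beta by rewrite sqr_sqrtr// ltW.
(* The condition on the discriminant enters here, together with lambda >= 0, to take square
   roots. *)
have x1 : 1 <= lambda / (2 * s).
  rewrite ler_pdivlMr ?mul1r ?mulr_gt0//.
  by rewrite -(ler_pXn2r (n := 2))// ?nnegrE ?mulr_ge0 ?(ltW s_gt0)// exprMn s2 -natrX.
have gam_le i : `|gam k (mu i)| <= gam k lambda.
  rewrite normrM ger0_norm ?exprn_ge0 ?(ltW s_gt0)//.
  rewrite ler_wpM2l ?exprn_ge0 ?(ltW s_gt0)// chebyshevU_max//.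
  rewrite divr_ge0 ?mulr_ge0 ?(ltW s_gt0) ?(psd_eigenvalue_ge0 (mu_eigen i))//=.
  by rewrite ler_pM2r ?invr_gt0 ?mulr_gt0// lambda_max.
have gam0 : 0 <= gam k lambda.
  rewrite mulr_ge0 ?exprn_ge0 ?(ltW s_gt0)// (le_trans _ (chebyshevU_ge k x1))//.
apply: (spectral_norm_le gam0) => v.
rewrite -(ler_pXn2r (n := 2))// ?nnegrE ?l2norm_ge0 ?(mulr_ge0 gam0) ?l2norm_ge0//.
(* The inequality is moved to the complex numbers, where the diagonalizing matrix lives. *)
rewrite exprMn !sqr_l2norm -lecR [leRHS]rmorphM /= !rmorph_sum /=.
have norm_toC x : `|toC x| ^+ 2 = toC (x ^+ 2).
  rewrite rmorphXn real_normK//; apply/CrealP.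
  by rewrite conj_Creal// complex_real.
have toCE n (u : 'cV[R]_n) j : toC (u j 0 ^+ 2) = `|map_mx toC u j 0| ^+ 2.
  by rewrite mxE norm_toC.
under eq_bigr do rewrite toCE map_mxM momentumE -!mulmxA.
under [in leRHS]eq_bigr do rewrite toCE.
(* Unitary invariance removes the inverse of [U] on the left and inserts [U] before v on the right,
   leaving a comparison coordinate by coordinate. *)
rewrite sqr_norm_unitary; last by rewrite invmx_unitary ?trmxC_unitary ?spectral_unitarymx.
rewrite -[in leRHS](sqr_norm_unitary _ (spectral_unitarymx AC)) -/U mulr_sumr.
apply: ler_sum => j _; rewrite mul_diag_mx !mxE normrM exprMn.
rewrite ler_wpM2r ?exprn_ge0 ?normr_ge0// norm_toC lecR.
by rewrite -[leLHS]real_normK ?num_real// ler_pXn2r ?nnegrE.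
Qed.

End SpectralBound.

(** * Second moments *)

(** To be read with v the norm of the covariance of the iterate, m that of its second moment and g
    the noise-free bound. Strong induction compares v with the solution of the renewal equation. *)
Lemma renewal_bound (R : realType) (g m v : nat -> R) (s : R) (t : nat) :
  0 <= s -> (forall i, 0 <= g i) ->
  (forall j, v j <= \sum_(i < j) g (j.-1 - i)%N * (s * m i)) ->
  (forall j, m j <= v j + g j) ->
  v t <= \sum_(1 <= n < t.+1)
     s ^+ n * \sum_(k in compositions (t - n) n.+1) \prod_(i < n.+1) g (k i).
Proof.
move=> s0 g0 v_le m_le; pose p := \poly_(j < t.+1) g j.
have pE j : (j <= t)%N -> p`_j = g j by rewrite coef_poly ltnS => ->.
have v_le_coef j : (j <= t)%N ->
    v j <= \sum_(1 <= n < j.+1) s ^+ n * (p ^+ n.+1)`_(j - n).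
  elim/ltn_ind: j => j IHj jt; rewrite (le_trans (v_le j))// -renewal_coef.
  apply: ler_sum => i _; have it : (i <= t)%N by rewrite (leq_trans _ jt)// ltnW.
  rewrite pE; last by rewrite (leq_trans (leq_subr _ _))// (leq_trans (leq_pred _)).
  (* The term g_i of m_i is the n = 0 summand, which completes the sum for v_i from n >= 1 to n >=
     0. *)
  rewrite !ler_wpM2l// (le_trans (m_le i))// big_ltn// expr0 mul1r subn0 expr1.
  by rewrite addrC pE// lerD2l IHj.
rewrite (le_trans (v_le_coef t (leqnn t)))// le_eqVlt; apply/orP; left; apply/eqP.
apply: eq_big_nat => n /andP[_ nt]; rewrite sum_compositions; congr (_ * _).
apply: coef_exp_trunc => j jtn; rewrite pE ?(leq_trans jtn) ?leq_subr//.
by rewrite coef_poly ltnS jtn.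
Qed.

(** * Recursions for Kronecker products of iterates *)

Section TensorBilinear.
Variables (R : comNzRingType) (m n p q : nat).

Lemma tensmxBl (M1 M2 : 'M[R]_(m, n)) (N : 'M[R]_(p, q)) :
  (M1 - M2) *t N = M1 *t N - M2 *t N.
Proof. by apply/matrixP => i j; rewrite !mxE mulrBl. Qed.

Lemma tensmxBr (M : 'M[R]_(m, n)) (N1 N2 : 'M[R]_(p, q)) :
  M *t (N1 - N2) = M *t N1 - M *t N2.
Proof. by apply/matrixP => i j; rewrite !mxE mulrBr. Qed.

Lemma tensmxZl k (M : 'M[R]_(m, n)) (N : 'M[R]_(p, q)) :
  (k *: M) *t N = k *: (M *t N).
Proof. by apply/matrixP => i j; rewrite !mxE mulrA. Qed.

Lemma tensmxZr k (M : 'M[R]_(m, n)) (N : 'M[R]_(p, q)) :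
  M *t (k *: N) = k *: (M *t N).
Proof. by apply/matrixP => i j; rewrite !mxE mulrCA. Qed.

End TensorBilinear.

Lemma tensmx11 (R : comNzRingType) d :
  (1%:M : 'M[R]_d) *t (1%:M : 'M[R]_d) = 1%:M.
Proof.
apply/matrixP => i j; rewrite -(mxtens_unindexK i) -(mxtens_unindexK j) !mxE !mxtens_indexK.
rewrite (can_eq (@mxtens_indexK d d)); case: mxtens_unindex => i1 i2.
by case: mxtens_unindex => j1 j2; rewrite xpair_eqE -natrM mulnb.
Qed.

Section TensorMomentum.
Variables (R : realType) (d : nat) (beta : R) (a : nat -> 'M[R]_d).
Local Notation F := (momentum beta a).
Local Notation F' := (momentum_prev beta a).

Lemma tens_momentumSS t : F t.+1 *t F t.+1 =
  (a t *t a t) *m (F t *t F t) - beta *: ((a t *t 1%:M) *m (F t *t F' t))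
  - beta *: ((1%:M *t a t) *m (F' t *t F t)) + beta ^+ 2 *: (F' t *t F' t).
Proof.
rewrite momentumS tensmxBl !tensmxBr !tensmxZl !tensmxZr !tensmx_mul !mul1mx.
by rewrite opprB scalerA -expr2 addrA addrAC.
Qed.

Lemma tens_momentumSl t : F t.+1 *t F' t.+1 =
  (a t *t 1%:M) *m (F t *t F t) - beta *: (F' t *t F t).
Proof. by rewrite momentum_prevS momentumS tensmxBl tensmxZl tensmx_mul mul1mx. Qed.

Lemma tens_momentumSr t : F' t.+1 *t F t.+1 =
  (1%:M *t a t) *m (F t *t F t) - beta *: (F t *t F' t).
Proof. by rewrite momentum_prevS momentumS tensmxBr tensmxZr tensmx_mul mul1mx. Qed.

End TensorMomentum.

(** * Duhamel's formula for the four second moments *)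

Section Duhamel.
Variables (R : realType) (d : nat) (beta : R) (A : 'M[R]_d) (Sigma : 'M[R]_(d * d)).
Variables M N N' L : nat -> 'M[R]_(d * d).
Hypotheses (M0 : M 0%N = 1%:M) (N0 : N 0%N = 0) (N'0 : N' 0%N = 0) (L0 : L 0%N = 0).
Hypothesis MS : forall t, M t.+1 = (A *t A + Sigma) *m M t
  - beta *: ((A *t 1%:M) *m N t) - beta *: ((1%:M *t A) *m N' t)
  + beta ^+ 2 *: L t.
Hypothesis NS : forall t, N t.+1 = (A *t 1%:M) *m M t - beta *: N' t.
Hypothesis N'S : forall t, N' t.+1 = (1%:M *t A) *m M t - beta *: N t.
Hypothesis LS : forall t, L t.+1 = M t.

Local Notation G := (momentum beta (fun=> A)).
Local Notation G' := (momentum_prev beta (fun=> A)).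

(** The noise applied to M_s is felt from time s + 1 on, hence the delay t - 1 - s; at t = 0 the sum
    is empty, so [t.-1] does no harm. *)
Let conv (K : nat -> 'M[R]_(d * d)) t :=
  \sum_(s < t) K (t.-1 - s)%N *m (Sigma *m M s).

(** Advancing time shifts the kernel and adds the newest impulse, so that the recursion of the
    kernel can be used inside the sum. *)
Let convS K t : conv K t.+1 = conv (K \o succn) t + K 0%N *m (Sigma *m M t).
Proof.
rewrite /conv big_ord_recr /= subnn; congr (_ + _); apply: eq_bigr => s _ /=.
by case: t s => [[]//|t] s /=; rewrite subSn// -ltnS.
Qed.

Let convD K1 K2 t : conv (fun k => K1 k + K2 k) t = conv K1 t + conv K2 t.
Proof. by rewrite /conv -big_split; apply: eq_bigr => s _; rewrite mulmxDl. Qed.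

Let convN K t : conv (fun k => - K k) t = - conv K t.
Proof. by rewrite /conv -sumrN; apply: eq_bigr => s _; rewrite mulNmx. Qed.

Let convZ K k t : conv (fun j => k *: K j) t = k *: conv K t.
Proof. by rewrite /conv scaler_sumr; apply: eq_bigr => s _; rewrite scalemxAl. Qed.

Let convM K B t : conv (fun j => B *m K j) t = B *m conv K t.
Proof. by rewrite /conv mulmx_sumr; apply: eq_bigr => s _; rewrite !mulmxA. Qed.

Let G'0 : G' 0 = 0. Proof. by []. Qed.

(** The Kronecker products of [G] and [G'] solve the same system with Sigma = 0. They start from the
    identity in the first slot and from 0 in the others, so they are also the response to a unit
    impulse in the equation of [M], the only one containing Sigma. All four formulas must be proved
    together. *)
Lemma duhamel t :
  M t = G t *t G t +
    \sum_(s < t) (G (t.-1 - s) *t G (t.-1 - s)) *m (Sigma *m M s).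
Proof.
suff [] : [/\ M t = G t *t G t + conv (fun k => G k *t G k) t,
  N t = G t *t G' t + conv (fun k => G k *t G' k) t,
  N' t = G' t *t G t + conv (fun k => G' k *t G k) t &
  L t = G' t *t G' t + conv (fun k => G' k *t G' k) t] by [].
elim: t => [|t [IHM IHN IHN' IHL]].
  by rewrite M0 N0 N'0 L0 /conv !big_ord0 !addr0 G'0 ?tens0mx ?tensmx0 tensmx11.
(* Since G'_0 = 0, the newest impulse survives only in the equation of [M]. *)
rewrite !convS/= G'0 !tens0mx !tensmx0 !mul0mx !addr0.
have comp_eq (K1 K2 : nat -> 'M[R]_(d * d)) : K1 =1 K2 -> conv K1 t = conv K2 t.
  by move=> K12; apply: eq_bigr => s _; rewrite K12.
have regroup (x1 x2 y1 y2 z1 z2 w1 w2 S : 'M[R]_(d * d)) :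
    x1 + x2 + S - (y1 + y2) - (z1 + z2) + (w1 + w2) =
    x1 - y1 - z1 + w1 + (x2 - y2 - z2 + w2 + S).
  by apply/matrixP => i j; rewrite !mxE; ring.
split.
- rewrite (comp_eq _ _ (fun k => tens_momentumSS beta (fun=> A) k)).
  rewrite tens_momentumSS !convD !convN !convZ !convM MS mulmxDl.
  rewrite tensmx11 mul1mx {1}IHM IHN IHN' IHL !mulmxDr !scalerDr.
  exact: regroup.
- rewrite (comp_eq _ _ (fun k => tens_momentumSl beta (fun=> A) k)).
  rewrite tens_momentumSl convD convN convZ convM NS {1}IHM IHN' mulmxDr scalerDr.
  by rewrite opprD addrACA.
- rewrite (comp_eq _ _ (fun k => tens_momentumSr beta (fun=> A) k)).
  rewrite tens_momentumSr convD convN convZ convM N'S {1}IHM IHN mulmxDr scalerDr.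
  by rewrite opprD addrACA.
- by rewrite LS {1}IHM momentum_prevS; congr (_ + _); apply: comp_eq => k /=; rewrite momentum_prevS.
Qed.
End Duhamel.

(** Coordinates are continuous, so they pull open intervals, which generate the Borel sets of the
    line, back to open sets. *)
Lemma measurable_entry (R : realType) m n (i : 'I_m) (j : 'I_n) :
  measurable_fun [set: borel_matrix R m n] (fun M : borel_matrix R m n => (M : 'M[R]_(m, n)) i j).
Proof.
apply: (measurability _ (RGenOpens.measurableE R)) => _ [_ [a [b ->]] <-].
rewrite setTI; apply: sub_sigma_algebra.
by apply: open_comp; [move=> M _; exact: coord_continuous|exact: interval_open].
Qed.

(** * Expectation and independence for random matrices *)

Section MatrixExpectation.
Context d d' (T : measurableType d) (T' : measurableType d') (R : realType).
Variable P : probability T R.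

Definition integrable_mx m n (W : T -> 'M[R]_(m, n)) : Prop :=
  forall i j, (fun w => W w i j) \in Lfun P 1.

Lemma expect_mxD m n (W1 W2 : T -> 'M[R]_(m, n)) :
  integrable_mx W1 -> integrable_mx W2 ->
  expect_mx P (fun w => W1 w + W2 w) = expect_mx P W1 + expect_mx P W2.
Proof.
move=> L1 L2; apply/matrixP => i j; rewrite !mxE.
rewrite -fineD ?expectation_fin_num// -expectationD//.
by congr (fine (expectation _ _)); apply/funext => w; rewrite mxE.
Qed.

Lemma expect_mxZ m n k (W : T -> 'M[R]_(m, n)) :
  integrable_mx W -> expect_mx P (fun w => k *: W w) = k *: expect_mx P W.
Proof.
move=> L; apply/matrixP => i j; rewrite !mxE.
rewrite -[k in RHS]/(fine k%:E) -fineM ?expectation_fin_num// -expectationZl//.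
by congr (fine (expectation _ _)); apply/funext => w; rewrite /= mxE mulrC.
Qed.

Lemma expect_mxB m n (W1 W2 : T -> 'M[R]_(m, n)) :
  integrable_mx W1 -> integrable_mx W2 ->
  expect_mx P (fun w => W1 w - W2 w) = expect_mx P W1 - expect_mx P W2.
Proof.
move=> L1 L2; apply/matrixP => i j; rewrite !mxE.
rewrite -fineB ?expectation_fin_num// -expectationB//.
by congr (fine (expectation _ _)); apply/funext => w; rewrite !mxE.
Qed.

Lemma expect_mx_cst m n (K : 'M[R]_(m, n)) : expect_mx P (fun=> K) = K.
Proof. by apply/matrixP => i j; rewrite mxE (expectation_cst P). Qed.

Lemma integrable_mxD m n (W1 W2 : T -> 'M[R]_(m, n)) :
  integrable_mx W1 -> integrable_mx W2 -> integrable_mx (fun w => W1 w + W2 w).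
Proof.
move=> L1 L2 i j; rewrite (_ : (fun w => _) = (fun w => W1 w i j) \+ (fun w => W2 w i j)) ?rpredD//.
by apply/funext => w; rewrite mxE.
Qed.

Lemma integrable_mxZ m n k (W : T -> 'M[R]_(m, n)) :
  integrable_mx W -> integrable_mx (fun w => k *: W w).
Proof.
move=> L i j; rewrite (_ : (fun w => _) = k *: (fun w => W w i j)) ?rpredZ//.
by apply/funext => w; rewrite mxE.
Qed.

Lemma integrable_mxB m n (W1 W2 : T -> 'M[R]_(m, n)) :
  integrable_mx W1 -> integrable_mx W2 -> integrable_mx (fun w => W1 w - W2 w).
Proof.
move=> L1 L2; under eq_fun do rewrite -scaleN1r; apply: integrable_mxD => //.
exact: integrable_mxZ.
Qed.

Lemma integrable_mx_cst m n (K : 'M[R]_(m, n)) : integrable_mx (fun=> K).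
Proof. by move=> i j; exact: Lfun_cst. Qed.

Lemma integrable_mx_tensl m n p q (K : 'M[R]_(m, n)) (W : T -> 'M[R]_(p, q)) :
  integrable_mx W -> integrable_mx (fun w => K *t W w).
Proof.
move=> L i j; set k := K (mxtens_unindex i).1 (mxtens_unindex j).1.
rewrite (_ : (fun w => _) = k *: (fun w => W w (mxtens_unindex i).2 (mxtens_unindex j).2)).
  by rewrite rpredZ.
by apply/funext => w; rewrite mxE.
Qed.

Lemma integrable_mx_tensr m n p q (K : 'M[R]_(m, n)) (W : T -> 'M[R]_(p, q)) :
  integrable_mx W -> integrable_mx (fun w => W w *t K).
Proof.
move=> L i j; set k := K (mxtens_unindex i).2 (mxtens_unindex j).2.
rewrite (_ : (fun w => _) = k *: (fun w => W w (mxtens_unindex i).1 (mxtens_unindex j).1)).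
  by rewrite rpredZ.
by apply/funext => w; rewrite mxE mulrC.
Qed.

Lemma expect_mx_tensl m n p q (K : 'M[R]_(m, n)) (W : T -> 'M[R]_(p, q)) :
  integrable_mx W -> expect_mx P (fun w => K *t W w) = K *t expect_mx P W.
Proof.
move=> L; apply/matrixP => i j; rewrite !mxE.
set k := K _ _; rewrite -[k in RHS]/(fine k%:E) -fineM ?expectation_fin_num// -expectationZl//.
by congr (fine (expectation _ _)); apply/funext => w; rewrite /= mxE mulrC.
Qed.

Lemma expect_mx_tensr m n p q (K : 'M[R]_(m, n)) (W : T -> 'M[R]_(p, q)) :
  integrable_mx W -> expect_mx P (fun w => W w *t K) = expect_mx P W *t K.
Proof.
move=> L; apply/matrixP => i j; rewrite !mxE mulrC.
set k := K _ _; rewrite -[k in RHS]/(fine k%:E) -fineM ?expectation_fin_num// -expectationZl//.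
by congr (fine (expectation _ _)); apply/funext => w; rewrite /= mxE.
Qed.

Variable X : nat -> {RV P >-> T'}.
Hypothesis X_indep : mutually_independent X.

(** Entrywise control suffices, since an entry of a product with a fresh matrix is a sum of products
    of one entry of each factor. *)
Definition indep_from_mx t m n (W : T -> 'M[R]_(m, n)) : Prop :=
  forall i j, indep_from X t (fun w => W w i j).

Lemma indep_from_mx_integrable t m n (W : T -> 'M[R]_(m, n)) :
  indep_from_mx t W -> integrable_mx W.
Proof. by move=> tW i j; exact: indep_from_Lfun (tW i j). Qed.

Lemma indep_from_mxS t m n (W : T -> 'M[R]_(m, n)) :
  indep_from_mx t W -> indep_from_mx t.+1 W.
Proof. by move=> tW i j; exact: indep_fromS (tW i j). Qed.

Lemma indep_from_mx_cst t m n (K : 'M[R]_(m, n)) : indep_from_mx t (fun=> K).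
Proof. by move=> i j; exact: indep_from_cst. Qed.

Lemma indep_from_mxZ t m n k (W : T -> 'M[R]_(m, n)) :
  indep_from_mx t W -> indep_from_mx t (fun w => k *: W w).
Proof.
move=> tW i j; have := indep_fromZ k (tW i j).
by congr indep_from; apply/funext => w; rewrite mxE /= mulrC.
Qed.

Lemma indep_from_mxD t m n (W1 W2 : T -> 'M[R]_(m, n)) :
  indep_from_mx t W1 -> indep_from_mx t W2 ->
  indep_from_mx t (fun w => W1 w + W2 w).
Proof.
move=> tW1 tW2 i j; have := indep_fromD (tW1 i j) (tW2 i j).
by congr indep_from; apply/funext => w; rewrite mxE.
Qed.

Lemma indep_from_mxB t m n (W1 W2 : T -> 'M[R]_(m, n)) :
  indep_from_mx t W1 -> indep_from_mx t W2 ->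
  indep_from_mx t (fun w => W1 w - W2 w).
Proof.
move=> tW1 tW2; under eq_fun do rewrite -scaleN1r; apply: indep_from_mxD => //.
exact: indep_from_mxZ.
Qed.

Lemma indep_from_mxM t m n p (W : T -> 'M[R]_(n, p)) (H : T' -> 'M[R]_(m, n)) :
  indep_from_mx t W -> (forall i j, measurable_fun setT (fun x => H x i j)) ->
  integrable_mx (H \o X t) ->
  indep_from_mx t.+1 (fun w => H (X t w) *m W w) /\
  expect_mx P (fun w => H (X t w) *m W w) = expect_mx P (H \o X t) *m expect_mx P W.
Proof.
move=> tW mH LH.
have HW i k j := indep_fromM X_indep (tW k j) (mH i k) (LH i k).
have entryE i j : (fun w => (H (X t w) *m W w) i j) = fun w =>
    \sum_k ((fun w => W w k j) \* ((fun x => H x i k) \o X t)) w.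
  by apply/funext => w; rewrite mxE; apply: eq_bigr => k _ /=; rewrite mulrC.
split; first by move=> i j; rewrite entryE; apply: indep_from_sum => // k; exact: (HW i k j).1.
apply/matrixP => i j; rewrite !mxE entryE.
set f := fun k => (fun w => W w k j) \* ((fun x => H x i k) \o X t).
have fE : fine 'E_P[fun w => (\sum_k f k w)%R]%E = \sum_k fine 'E_P[f k]%E.
  have fL k : f k \in Lfun P 1 := indep_from_Lfun (HW i k j).1.
  have -> : (fun w => \sum_k f k w)%R = (\sum_k f k)%R by apply/funext => w; rewrite fct_sumE.
  (* Integrability of the partial sums is carried through the induction, as additivity of the
     expectation depends on it. *)
  have [_ //] : (\sum_k f k \in Lfun P 1) /\
     fine 'E_P[(\sum_k f k)%R]%E = \sum_k fine 'E_P[f k]%E.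
  elim/big_ind2 : _ => //.
    by split; [exact: Lfun_cst|rewrite (expectation_cst P)].
  move=> g1 a1 g2 a2 [L1 <-] [L2 <-]; split; first by rewrite rpredD.
  by rewrite (expectationD L1 L2) fineD// expectation_fin_num.
rewrite fE; apply: eq_bigr => k _; rewrite !mxE mulrC; exact: (HW i k j).2.
Qed.

End MatrixExpectation.

(** * First and second moments of the random iterates *)

Section MomentumMoments.
Context (R : realType) (d : nat) (A : 'M[R]_d) (beta : R)
  (disp : measure_display) (T : measurableType disp) (P : probability T R)
  (X : nat -> {RV P >-> borel_matrix R d d}) (Sigma : 'M[R]_(d * d)).
Hypothesis X_indep : mutually_independent X.
Hypothesis X_L2 : forall t, finite_second_moments P (X t).
Hypothesis X_mean : forall t, expect_mx P (X t) = A.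
Hypothesis X_cov : forall t,
  expect_mx P (fun w => (X t w - A) *t (X t w - A)) = Sigma.

Let F t w := momentum beta (fun s => X s w) t.
Let F' t w := momentum_prev beta (fun s => X s w) t.
Local Notation E W := (expect_mx P W).

Let FS t : F t.+1 = fun w => (X t w : 'M[R]_d) *m F t w - beta *: F' t w.
Proof. by apply/funext => w; exact: momentumS. Qed.

Let F'S t : F' t.+1 = F t.
Proof. by apply/funext => w; exact: momentum_prevS. Qed.

Let X_L1 t : integrable_mx P (X t : T -> 'M[R]_d).
Proof.
move=> i j; apply: (@Lfun_subset12 _ _ _ P); first exact: fin_num_measure.
exact: X_L2.
Qed.

(** The second-moment hypothesis is used in full here: a product of two L2 entries is in L1. *)
Let XX_L1 t : integrable_mx P (fun w => (X t w : 'M[R]_d) *t (X t w : 'M[R]_d)).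
Proof.
move=> i j; set f := fun w => (X t w : 'M[R]_d) (mxtens_unindex i).1 (mxtens_unindex j).1.
rewrite (_ : (fun w => _) = f \* fun w => (X t w : 'M[R]_d) (mxtens_unindex i).2 (mxtens_unindex j).2).
  by apply: Lfun2_mul_Lfun1; exact: X_L2.
by apply/funext => w; rewrite mxE.
Qed.

(** Expansion around the mean: each of the two cross terms has mean A (x) A, and one of them cancels
    against the constant. *)
Let E_XX t : E (fun w => (X t w : 'M[R]_d) *t (X t w : 'M[R]_d)) = A *t A + Sigma.
Proof.
have XE w : (X t w : 'M[R]_d) *t (X t w : 'M[R]_d) =
    ((X t w - A) *t (X t w - A) + A *t (X t w : 'M[R]_d)) +
    ((X t w : 'M[R]_d) *t A - A *t A).
  by rewrite tensmxBl !tensmxBr; apply/matrixP => i j; rewrite !mxE; ring.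
have LA : integrable_mx P (fun w => A *t (X t w : 'M[R]_d)) by exact: integrable_mx_tensl.
have LA' : integrable_mx P (fun w => (X t w : 'M[R]_d) *t A) by exact: integrable_mx_tensr.
have LAA : integrable_mx P (fun w => (X t w : 'M[R]_d) *t A - A *t A).
  by apply: integrable_mxB => //; exact: integrable_mx_cst.
have LC : integrable_mx P (fun w => (X t w - A) *t (X t w - A)).
  have XE' w : (X t w - A) *t (X t w - A) =
    ((X t w : 'M[R]_d) *t (X t w : 'M[R]_d) - A *t (X t w : 'M[R]_d)) -
    ((X t w : 'M[R]_d) *t A - A *t A).
    by rewrite tensmxBl !tensmxBr; apply/matrixP => i j; rewrite !mxE; ring.
  under eq_fun do rewrite XE'.
  by apply: integrable_mxB => //; exact: integrable_mxB.
under eq_fun do rewrite XE.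
rewrite expect_mxD//; last exact: integrable_mxD.
rewrite expect_mxD// expect_mxB//; last exact: integrable_mx_cst.
rewrite X_cov expect_mx_tensl// expect_mx_tensr// X_mean expect_mx_cst subrr addr0.
by rewrite addrC.
Qed.

(** This and the next three facts instantiate the product rule for the coefficients of the
    recursions: X_t, X_t (x) I, I (x) X_t and X_t (x) X_t. *)
Let mulX t n (W : T -> 'M[R]_(d, n)) : indep_from_mx X t W ->
  indep_from_mx X t.+1 (fun w => (X t w : 'M[R]_d) *m W w) /\
  E (fun w => (X t w : 'M[R]_d) *m W w) = A *m E W.
Proof.
move=> tW; rewrite -(X_mean t).
apply: (indep_from_mxM X_indep (H := fun M : borel_matrix R d d => (M : 'M[R]_d))) => //.
  by move=> i j; exact: measurable_entry.
exact: X_L1.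
Qed.

Let mulXl t n (W : T -> 'M[R]_(d * d, n)) : indep_from_mx X t W ->
  indep_from_mx X t.+1 (fun w => ((X t w : 'M[R]_d) *t 1%:M) *m W w) /\
  E (fun w => ((X t w : 'M[R]_d) *t 1%:M) *m W w) = (A *t 1%:M) *m E W.
Proof.
move=> tW; rewrite -(X_mean t) -expect_mx_tensr; last exact: X_L1.
apply: (indep_from_mxM X_indep (H := fun M : borel_matrix R d d => (M : 'M[R]_d) *t 1%:M)) => //.
  move=> i j; under eq_fun do rewrite mxE.
  by apply: measurable_funM => //; exact: measurable_entry.
exact/integrable_mx_tensr/X_L1.
Qed.

Let mulXr t n (W : T -> 'M[R]_(d * d, n)) : indep_from_mx X t W ->
  indep_from_mx X t.+1 (fun w => (1%:M *t (X t w : 'M[R]_d)) *m W w) /\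
  E (fun w => (1%:M *t (X t w : 'M[R]_d)) *m W w) = (1%:M *t A) *m E W.
Proof.
move=> tW; rewrite -(X_mean t) -expect_mx_tensl; last exact: X_L1.
apply: (indep_from_mxM X_indep (H := fun M : borel_matrix R d d => 1%:M *t (M : 'M[R]_d))) => //.
  move=> i j; under eq_fun do rewrite mxE.
  by apply: measurable_funM => //; exact: measurable_entry.
exact/integrable_mx_tensl/X_L1.
Qed.

Let mulXX t n (W : T -> 'M[R]_(d * d, n)) : indep_from_mx X t W ->
  indep_from_mx X t.+1 (fun w => ((X t w : 'M[R]_d) *t (X t w : 'M[R]_d)) *m W w) /\
  E (fun w => ((X t w : 'M[R]_d) *t (X t w : 'M[R]_d)) *m W w) = (A *t A + Sigma) *m E W.
Proof.
move=> tW; rewrite -(E_XX t).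
apply: (indep_from_mxM X_indep (H := fun M : borel_matrix R d d => (M : 'M[R]_d) *t (M : 'M[R]_d))) => //.
  move=> i j; under eq_fun do rewrite mxE.
  by apply: measurable_funM => //; exact: measurable_entry.
exact: XX_L1.
Qed.

Let indep_F t : indep_from_mx X t (F t) /\ indep_from_mx X t (F' t).
Proof.
elim: t => [|t [IH IH']]; first by split; exact: indep_from_mx_cst.
split; last by rewrite F'S; exact: indep_from_mxS.
rewrite FS.
apply: indep_from_mxB; first exact: (mulX IH).1.
exact/indep_from_mxZ/indep_from_mxS.
Qed.

Lemma expect_momentum t : E (F t) = momentum beta (fun=> A) t.
Proof.
suff [] : E (F t) = momentum beta (fun=> A) t /\
  E (F' t) = momentum_prev beta (fun=> A) t by [].
elim: t => [|t [IH IH']]; first by split; exact: expect_mx_cst.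
split; last first.
  by rewrite momentum_prevS -IH F'S.
rewrite FS momentumS.
have [tF tF'] := indep_F t.
rewrite expect_mxB; last 2 first.
- exact: indep_from_mx_integrable (mulX tF).1.
- exact/integrable_mxZ/(indep_from_mx_integrable tF').
rewrite (mulX tF).2 expect_mxZ; last exact: (indep_from_mx_integrable tF').
by rewrite -IH -IH'.
Qed.

Let FF t w := F t w *t F t w.
Let FF' t w := F t w *t F' t w.
Let F'F t w := F' t w *t F t w.
Let F'F' t w := F' t w *t F' t w.

Let FF0 : FF 0 = fun=> 1%:M.
Proof. by apply/funext => w; exact: tensmx11. Qed.

Let FF'0 : FF' 0 = fun=> 0.
Proof. by apply/funext => w; exact: tensmx0. Qed.

Let F'F0 : F'F 0 = fun=> 0.
Proof. by apply/funext => w; exact: tens0mx. Qed.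

Let F'F'0 : F'F' 0 = fun=> 0.
Proof. by apply/funext => w; exact: tens0mx. Qed.

Let FFS t : FF t.+1 = fun w =>
  ((X t w : 'M[R]_d) *t (X t w : 'M[R]_d)) *m FF t w -
  beta *: (((X t w : 'M[R]_d) *t 1%:M) *m FF' t w) -
  beta *: ((1%:M *t (X t w : 'M[R]_d)) *m F'F t w) + beta ^+ 2 *: F'F' t w.
Proof. by apply/funext => w; exact: tens_momentumSS. Qed.

Let FF'S t : FF' t.+1 = fun w =>
  ((X t w : 'M[R]_d) *t 1%:M) *m FF t w - beta *: F'F t w.
Proof. by apply/funext => w; exact: tens_momentumSl. Qed.

Let F'FS t : F'F t.+1 = fun w =>
  (1%:M *t (X t w : 'M[R]_d)) *m FF t w - beta *: FF' t w.
Proof. by apply/funext => w; exact: tens_momentumSr. Qed.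

Let F'F'S t : F'F' t.+1 = FF t.
Proof. by apply/funext => w; rewrite /F'F' F'S. Qed.

(** This cannot be read off from [indep_F]: both factors depend on the same past, and a product of
    integrable variables need not be integrable. The linear recursions avoid this, since they only
    multiply by a function of the fresh matrix [X t]. *)
Let indep_FF t : [/\ indep_from_mx X t (FF t), indep_from_mx X t (FF' t),
  indep_from_mx X t (F'F t) & indep_from_mx X t (F'F' t)].
Proof.
elim: t => [|t [IH1 IH2 IH3 IH4]].
  by rewrite FF0 FF'0 F'F0 F'F'0; split; exact: indep_from_mx_cst.
split.
- rewrite FFS; apply: indep_from_mxD; last exact/indep_from_mxZ/indep_from_mxS.
  apply: indep_from_mxB; last exact/indep_from_mxZ/(mulXr IH3).1.
  by apply: indep_from_mxB; [exact: (mulXX IH1).1|exact/indep_from_mxZ/(mulXl IH2).1].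
- rewrite FF'S; apply: indep_from_mxB; first exact: (mulXl IH1).1.
  exact/indep_from_mxZ/indep_from_mxS.
- rewrite F'FS; apply: indep_from_mxB; first exact: (mulXr IH1).1.
  exact/indep_from_mxZ/indep_from_mxS.
- by rewrite F'F'S; exact: indep_from_mxS.
Qed.

Lemma expect_tens_momentum t :
  E (FF t) = momentum beta (fun=> A) t *t momentum beta (fun=> A) t +
    \sum_(s < t) (momentum beta (fun=> A) (t.-1 - s) *t
                  momentum beta (fun=> A) (t.-1 - s)) *m (Sigma *m E (FF s)).
Proof.
have L := indep_from_mx_integrable.
apply: (@duhamel _ _ beta A Sigma (fun t => E (FF t)) (fun t => E (FF' t))
  (fun t => E (F'F t)) (fun t => E (F'F' t))).
- by rewrite FF0 expect_mx_cst.
- by rewrite FF'0 expect_mx_cst.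
- by rewrite F'F0 expect_mx_cst.
- by rewrite F'F'0 expect_mx_cst.
- move=> s; have [t1 t2 t3 t4] := indep_FF s.
  have [[/L L1 E1] [/L L2 E2]] := (mulXX t1, mulXl t2).
  have [[/L L3 E3] /L L4] := (mulXr t3, t4).
  have Z2 := integrable_mxZ beta L2; have Z3 := integrable_mxZ beta L3.
  have B12 := integrable_mxB L1 Z2.
  rewrite FFS expect_mxD ?expect_mxB ?expect_mxZ// ?E1 ?E2 ?E3//.
    exact: integrable_mxB.
  exact: integrable_mxZ.
- move=> s; have [t1 t2 t3 t4] := indep_FF s.
  have [[/L L1 E1] /L L3] := (mulXl t1, t3).
  by rewrite FF'S expect_mxB ?expect_mxZ ?E1//; exact: integrable_mxZ.
- move=> s; have [t1 t2 t3 t4] := indep_FF s.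
  have [[/L L1 E1] /L L3] := (mulXr t1, t2).
  by rewrite F'FS expect_mxB ?expect_mxZ ?E1//; exact: integrable_mxZ.
- by move=> s; rewrite F'F'S.
Qed.

End MomentumMoments.

(* [X t] is the random matrix A_(t+1), so that [X 0, X 1, ...] is A_1, A_2, ... *)
Theorem lemma6 (R : realType) (d : nat) (A : 'M[R]_d) (lambda1 beta : R)
    (disp : measure_display) (T : measurableType disp) (P : probability T R)
    (X : nat -> {RV P >-> borel_matrix R d d}) (Sigma : 'M[R]_(d * d))
    (A_sym : A^T = A)
    (A_psd : possemidef A)
    (lambda1_largest : largest_eigenvalue A lambda1)
    (beta_gt0 : 0 < beta)
    (lambda1_beta : 4 * beta <= lambda1 ^+ 2)
    (X_indep : mutually_independent X)
    (X_idd : identically_distributed X)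
    (X_L2 : forall t, finite_second_moments P (X t))
    (X_mean : forall t, expect_mx P (X t) = A)
    (X_cov : forall t,
      expect_mx P (fun w => (X t w - A) *t (X t w - A)) = Sigma)
    (F := fun (t : nat) (w : T) => momentum beta (fun s => X s w) t)
    (t : nat) :
  spectral_norm (expect_mx P (fun w => F t w *t F t w)
                 - expect_mx P (F t) *t expect_mx P (F t))
  <= \sum_(1 <= n < t.+1)
       spectral_norm Sigma ^+ n * beta ^+ (t - n) *
       \sum_(k in compositions (t - n) n.+1)
         \prod_(i < n.+1)
           (chebyshevU R (k i)).[lambda1 / (2 * Num.sqrt beta)] ^+ 2.
Proof.
pose g k := beta ^+ k * (chebyshevU R k).[lambda1 / (2 * Num.sqrt beta)] ^+ 2.
pose G k := momentum beta (fun=> A) k.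
pose M k := expect_mx P (fun w => F k w *t F k w).
have GG_le k : spectral_norm (G k *t G k) <= g k.
  have Gk := spectral_norm_momentum_cst A_sym A_psd lambda1_largest beta_gt0 lambda1_beta k.
  rewrite (le_trans (spectral_norm_tensmx _ _))//.
  rewrite (le_trans (ler_pM (spectral_norm_ge0 _) (spectral_norm_ge0 _) Gk Gk))//.
  by rewrite -expr2 exprMn exprAC sqr_sqrtr// ltW.
have g_ge0 k : 0 <= g k by rewrite mulr_ge0 ?sqr_ge0// exprn_ge0// ltW.
have ME k : M k = G k *t G k +
    \sum_(s < k) (G (k.-1 - s)%N *t G (k.-1 - s)%N) *m (Sigma *m M s).
  exact: (expect_tens_momentum beta X_indep X_L2 X_mean X_cov).
have EF k : expect_mx P (F k) = G k.
  exact: (expect_momentum beta X_indep X_L2 X_mean).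
rewrite EF -/(M t).
apply: (@le_trans _ _ (\sum_(1 <= n < t.+1) spectral_norm Sigma ^+ n *
    \sum_(k in compositions (t - n) n.+1) \prod_(i < n.+1) g (k i))); last first.
  (* On a composition of t - n the factors beta^(k_i) multiply to beta^(t - n). *)
  rewrite le_eqVlt; apply/orP; left; apply/eqP; apply: eq_big_nat => n _.
  rewrite -mulrA; congr (_ * _); rewrite mulr_sumr; apply: eq_bigr => k.
  by rewrite inE => /eqP/esym/(congr1 (GRing.exp beta)) ->; rewrite expr_sum -big_split.
apply: (@renewal_bound _ g (fun k => spectral_norm (M k))
  (fun k => spectral_norm (M k - G k *t G k))) => //.
- exact: spectral_norm_ge0.
(* Subtracting G_j (x) G_j leaves exactly the Duhamel sum, bounded by submultiplicativity. *)
- move=> j; rewrite ME addrC addKr (le_trans (spectral_norm_sum _ _))//.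
  apply: ler_sum => i _; rewrite (le_trans (spectral_normM _ _))//.
  by rewrite ler_pM ?spectral_norm_ge0 ?spectral_normM.
- move=> j; rewrite -[X in spectral_norm X](subrK (G j *t G j)).
  by rewrite (le_trans (spectral_normD _ _))// lerD2l.
Qed.
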